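(* Let $(M,g_{ab})$ be a $3$-dimensional spacetime with signature $(-,+,+)$, and let $X_{abcd}$ be a real tensor field on $M$ satisfying $X_{abcd}=-X_{bacd}=-X_{abdc}$ (no other symmetry is assumed). Define the symmetric contravariant tensor (effective optical metric) $$\hat g^{i_1i_2}(x)=-\frac12\,{}^{\star}X^{k_1k_2(i_1}\,X^{\star\,i_2)}{}_{k_1k_2},$$ which is quadratic in $X$. Let $x\in M$ and let $k\in T_x^*M$ be a nonzero covector. Then the equation $$(X^{ambn}k_mk_n)\,a_b=0$$ admits a nontrivial solution, i.e. a solution $a\in T_x^*M$ that is not a scalar multiple of $k$, if and only if $$\hat g^{ab}(x)k_ak_b=0.$$
   Context: Indices take values $0,1,2$ and are raised and lowered with $g_{ab}$; the summation convention is used. The Levi-Civita tensor is $\varepsilon_{abc}=\sqrt{-g}\,[abc]$, $\varepsilon^{abc}=-\frac{1}{\sqrt{-g}}[abc]$, where $g=\det(g_{ab})$ and $[abc]$ is the totally antisymmetric symbol with $[012]=+1$. The right and left Hodge duals of $X$ are $$X^{\star}{}_{abc}=\tfrac12 X_{abpq}\,\varepsilon^{pq}{}_{c},\qquad {}^{\star}X_{abc}=\tfrac12 X_{pqbc}\,\varepsilon^{pq}{}_{a}.$$ Round brackets denote symmetrization with weight $\frac12$ over the two indices $i_1,i_2$: explicitly, $\hat g^{i_1i_2}=-\frac14\left({}^{\star}X^{k_1k_2i_1}X^{\star\,i_2}{}_{k_1k_2}+{}^{\star}X^{k_1k_2i_2}X^{\star\,i_1}{}_{k_1k_2}\right)$.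 Here $k_a$ is the wave covector and $a_a$ the polarization $1$-form of an electromagnetic disturbance with amplitude $f_{ab}=k_aa_b-k_ba_a$, so that multiples of $k$ are trivial (they give $f_{ab}=0$). *)

(* Defs.v *)
From HB Require Import structures.
From mathcomp Require Import all_boot all_order all_algebra.
From mathcomp Require Import all_classical all_reals all_analysis.
Set Implicit Arguments.
Unset Strict Implicit.
Unset Printing Implicit Defensive.
Import Order.TTheory GRing.Theory Num.Theory.
Import numFieldNormedType.Exports.
Local Open Scope classical_set_scope.
Local Open Scope ring_scope.

Fixpoint Ck_on (R : realType) (V W : normedModType R) (n : nat)
    (U : set V) (f : V -> W) : Prop :=
  match n with
  | 0 => forall y, U y -> {for y, continuous f}
  | m.+1 => (forall y, U y -> differentiable f y) /\
            (forall v, Ck_on m U (fun y => 'D_v f y))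
  end.

Definition smooth_on (R : realType) (V W : normedModType R)
  (U : set V) (f : V -> W) : Prop := forall n, Ck_on n U f.

(** [coord] and [param] are total functions, meaningful only on [dom] and on
    its image respectively. *)
Record chart (R : realType) (M : topologicalType) := Chart {
  dom : set M;
  coord : M -> 'rV[R]_3;
  param : 'rV[R]_3 -> M;
  dom_open : open dom;
  image_open : open (coord @` dom);
  coordK : forall x, dom x -> param (coord x) = x;
  coord_continuous : forall x, dom x -> {for x, continuous coord};
  param_continuous : forall y, (coord @` dom) y -> {for y, continuous param}
}.

Definition transition (R : realType) (M : topologicalType) (c c' : chart R M) :
  'rV[R]_3 -> 'rV[R]_3 := coord c' \o param c.

Record manifold3 (R : realType) := Manifold3 {
  points :> topologicalType;
  atlas : set (chart R points);
  points_hausdorff : hausdorff_space points;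
  points_second_countable : @second_countable points;
  atlas_cover : forall x : points, exists2 c, atlas c & dom c x;
  atlas_smooth : forall c c', atlas c -> atlas c' ->
    smooth_on (coord c @` (dom c `&` dom c')) (transition c c')
}.

(** [tchange c c' x a b] is the partial derivative at [x] of the b-th
    coordinate of [c'] with respect to the a-th coordinate of [c]. *)
Definition tchange (R : realType) (M : topologicalType) (c c' : chart R M)
  (x : M) : 'M[R]_3 := jacobian (transition c c') (coord c x).

(** A covariant tensor field of rank [n], given by its components in each chart
    of the atlas, subject to
    T'_{a_1...a_n} = (d x^{b_1} / d x'^{a_1}) ... (d x^{b_n} / d x'^{a_n})
                     T_{b_1...b_n};
    components at points outside the domain of the chart are irrelevant. *)
Record tensor_field (R : realType) (M : manifold3 R) (n : nat) := TensorField {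
  comp :> chart R M -> M -> n.-tuple 'I_3 -> R;
  comp_change : forall (c c' : chart R M) (x : M) (I : n.-tuple 'I_3),
    atlas c -> atlas c' -> dom c x -> dom c' x ->
    comp c' x I =
      \sum_(J : n.-tuple 'I_3)
        (\prod_(i < n) tchange c' c x (tnth I i) (tnth J i)) * comp c x J
}.

Definition smooth_tensor (R : realType) (M : manifold3 R) (n : nat)
    (T : tensor_field M n) : Prop :=
  forall (c : chart R M) (I : n.-tuple 'I_3), atlas c ->
    smooth_on (W := R^o) (coord c @` dom c) (fun y => T c (param c y) I).

Definition metric_at (R : realType) (M : manifold3 R) (g : tensor_field M 2)
  (c : chart R M) (x : M) : 'M[R]_3 := \matrix_(a, b) g c x [tuple a; b].

Definition tensor4_at (R : realType) (M : manifold3 R) (X : tensor_field M 4)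
  (c : chart R M) (x : M) (a b d e : 'I_3) : R := X c x [tuple a; b; d; e].

(** Symmetric with an orthonormal frame (the rows of [P]) of signs (-,+,+). *)
Definition signature_mpp (R : realType) (G : 'M[R]_3) : Prop :=
  G^T = G /\
  exists2 P : 'M[R]_3, P \in unitmx &
    P *m G *m P^T = diag_mx (\row_(i < 3) if i == 0 then -1 else 1).

Definition lorentzian (R : realType) (M : manifold3 R)
    (g : tensor_field M 2) : Prop :=
  smooth_tensor g /\
  forall (c : chart R M) (x : M), atlas c -> dom c x ->
    signature_mpp (metric_at g c x).

Definition pairwise_antisymmetric (R : realType) (M : manifold3 R)
    (X : tensor_field M 4) : Prop :=
  forall (c : chart R M) (x : M) (a b d e : 'I_3), atlas c -> dom c x ->
    tensor4_at X c x a b d e = - tensor4_at X c x b a d e /\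
    tensor4_at X c x a b d e = - tensor4_at X c x a b e d.

(** From here on, [G] is the matrix g_{ab} and [X] the array X_{abcd} of
    components at a point, in the coordinate basis of some chart, so [invmx G]
    is g^{ab}. *)

Definition perm_symbol (R : realType) (a b c : 'I_3) : R :=
  match nat_of_ord a, nat_of_ord b, nat_of_ord c with
  | 0, 1, 2 | 1, 2, 0 | 2, 0, 1 => 1
  | 0, 2, 1 | 2, 1, 0 | 1, 0, 2 => -1
  | _, _, _ => 0
  end.

(** eps^{abc} *)
Definition eps_up (R : realType) (G : 'M[R]_3) (a b c : 'I_3) : R :=
  - (Num.sqrt (- \det G))^-1 * perm_symbol R a b c.

(** eps^{pq}_c *)
Definition eps_mixed (R : realType) (G : 'M[R]_3) (p q c : 'I_3) : R :=
  \sum_(r < 3) eps_up G p q r * G r c.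

(** X*_{abc} *)
Definition right_dual (R : realType) (G : 'M[R]_3)
    (X : 'I_3 -> 'I_3 -> 'I_3 -> 'I_3 -> R) (a b c : 'I_3) : R :=
  2^-1 * \sum_(p < 3) \sum_(q < 3) X a b p q * eps_mixed G p q c.

(** *X_{abc} *)
Definition left_dual (R : realType) (G : 'M[R]_3)
    (X : 'I_3 -> 'I_3 -> 'I_3 -> 'I_3 -> R) (a b c : 'I_3) : R :=
  2^-1 * \sum_(p < 3) \sum_(q < 3) X p q b c * eps_mixed G p q a.

(** X*^a_{bc} *)
Definition right_dual_raise1 (R : realType) (G : 'M[R]_3)
    (X : 'I_3 -> 'I_3 -> 'I_3 -> 'I_3 -> R) (a b c : 'I_3) : R :=
  \sum_(d < 3) invmx G a d * right_dual G X d b c.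

(** *X^{abc} *)
Definition left_dual_up (R : realType) (G : 'M[R]_3)
    (X : 'I_3 -> 'I_3 -> 'I_3 -> 'I_3 -> R) (a b c : 'I_3) : R :=
  \sum_(d < 3) \sum_(e < 3) \sum_(f < 3)
    invmx G a d * invmx G b e * invmx G c f * left_dual G X d e f.

(** X^{abcd} *)
Definition raise4 (R : realType) (G : 'M[R]_3)
    (X : 'I_3 -> 'I_3 -> 'I_3 -> 'I_3 -> R) (a b c d : 'I_3) : R :=
  \sum_(p < 3) \sum_(q < 3) \sum_(r < 3) \sum_(s < 3)
    invmx G a p * invmx G b q * invmx G c r * invmx G d s * X p q r s.

(** *X^{k1 k2 i} X*^j_{k1 k2} *)
Definition dual_square (R : realType) (G : 'M[R]_3)
    (X : 'I_3 -> 'I_3 -> 'I_3 -> 'I_3 -> R) (i j : 'I_3) : R :=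
  \sum_(k1 < 3) \sum_(k2 < 3)
    left_dual_up G X k1 k2 i * right_dual_raise1 G X j k1 k2.

Definition optical_metric (R : realType) (G : 'M[R]_3)
    (X : 'I_3 -> 'I_3 -> 'I_3 -> 'I_3 -> R) (i j : 'I_3) : R :=
  - 2^-1 * (2^-1 * (dual_square G X i j + dual_square G X j i)).

(* Main.v *)
Require Import Defs.
From HB Require Import structures.
From mathcomp Require Import all_boot all_order all_algebra.
From mathcomp Require Import all_classical all_reals all_analysis.
From mathcomp Require Import ring lra.
Set Implicit Arguments.
Unset Strict Implicit.
Unset Printing Implicit Defensive.
Import Order.TTheory GRing.Theory Num.Theory.
Import numFieldNormedType.Exports.
Local Open Scope ring_scope.

(** Writing X_{abcd} = [abf] [cde] D_{ef}, both sides of the equivalence depend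
    only on V = g D g and on the cross-product matrix K = [abe] k_e. The wave
    operator X^{ambn} k_m k_n is, up to transposition and a nonzero factor,
    K V K, while ghat(k, k) is a nonzero multiple of tr (K V K V^T).
    Since K V K annihilates k on both sides, it has a kernel vector outside
    the line of k iff k^T k - K V K is singular (over the reals k k^T != 0), and
    2 det (k^T k - K V K) = - |k|^4 tr (K V K V^T), where |k| is the Euclidean
    norm of the components. *)

(** * Cross-product matrices in dimension three *)

Definition skew (R : realType) (v : 'rV[R]_3) : 'M[R]_3 :=
  \matrix_(a, b) \sum_(e < 3) perm_symbol R a b e * v 0 e.

Lemma forall_ord3 (P : 'I_3 -> Prop) : P 0 -> P 1 -> P 2 -> forall i, P i.
Proof.
move=> P0 P1 P2 [[|[|[|//]]] lt_i3].
- by rewrite (_ : Ordinal _ = 0) //; exact: val_inj.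
- by rewrite (_ : Ordinal _ = 1) //; exact: val_inj.
- by rewrite (_ : Ordinal _ = 2) //; exact: val_inj.
Qed.

Lemma sum_ord3 (V : nmodType) (F : 'I_3 -> V) :
  \sum_(i < 3) F i = F 0 + F 1 + F 2.
Proof.
rewrite !big_ord_recl big_ord0 addr0 addrA; congr (F _ + F _ + F _);
  exact: val_inj.
Qed.

Lemma det3 (R : comPzRingType) (A : 'M[R]_3) :
  \det A = A 0 0 * (A 1 1 * A 2 2 - A 1 2 * A 2 1)
         - A 0 1 * (A 1 0 * A 2 2 - A 1 2 * A 2 0)
         + A 0 2 * (A 1 0 * A 2 1 - A 1 1 * A 2 0).
Proof.
pose f (i j : nat) := A (inord i) (inord j).
have -> : A = \matrix_(i, j) f i j.
  by apply/matrixP=> i j; rewrite mxE /f !inord_val.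
rewrite (expand_det_row _ 0) sum_ord3 /cofactor !(expand_det_row _ 0).
rewrite !big_ord_recl !big_ord0 /cofactor !det_mx11 !mxE /= /bump /=.
ring.
Qed.

Lemma tr_skew (R : realType) (v : 'rV[R]_3) : (skew v)^T = - skew v.
Proof.
apply/matrixP; apply: forall_ord3; apply: forall_ord3;
  rewrite !mxE !sum_ord3 /perm_symbol /=; ring.
Qed.

Lemma skewC (R : realType) (v : 'rV[R]_3) (a b : 'I_3) :
  skew v a b = - skew v b a.
Proof. by have /matrixP/(_ b a) := tr_skew v; rewrite !mxE. Qed.

(** The cyclic entries (1,2), (2,0), (0,1) determine an antisymmetric array. Index additions are
    modulo 3, so (e+1, e+2, e) is an even permutation and the sign is +1. *)
Lemma skew_antisym (R : realType) (B : 'I_3 -> 'I_3 -> R) (a b : 'I_3) :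
  (forall a b, B a b = - B b a) ->
  B a b = skew (\row_e B (e + 1) (e + 2)) a b.
Proof.
move=> B_anti; have B0 c : B c c = 0 by have := B_anti c c; lra.
rewrite mxE sum_ord3 !mxE.
have -> : (0 + 1 : 'I_3) = 1 by exact: val_inj.
have -> : (0 + 2 : 'I_3) = 2 by exact: val_inj.
have -> : (1 + 1 : 'I_3) = 2 by exact: val_inj.
have -> : (1 + 2 : 'I_3) = 0 by exact: val_inj.
have -> : (2 + 1 : 'I_3) = 0 by exact: val_inj.
have -> : (2 + 2 : 'I_3) = 1 by exact: val_inj.
move: a b; apply: forall_ord3; apply: forall_ord3; rewrite /perm_symbol /= ?B0
  ?(B_anti 1 0) ?(B_anti 2 1) ?(B_anti 0 2); ring.
Qed.

(** This is H_ap H_bq H_ce [pqe] = det H [abc], contracted with w_c. *)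
Lemma skew_congr (R : realType) (H : 'M[R]_3) (w : 'rV[R]_3) :
  H *m skew (w *m H) *m H^T = \det H *: skew w.
Proof.
rewrite det3; apply/matrixP; apply: forall_ord3; apply: forall_ord3;
  rewrite !(mxE, sum_ord3) /perm_symbol /=; ring.
Qed.

Lemma skew_congr_sum (R : realType) (H : 'M[R]_3) (w : 'rV[R]_3) (a b : 'I_3) :
  \sum_(p < 3) \sum_(q < 3) H a p * H b q * skew (w *m H) p q =
  \det H * skew w a b.
Proof.
have /matrixP/(_ a b) := skew_congr H w.
rewrite [in RHS]mxE => <-; rewrite mxE exchange_big /=.
apply: eq_bigr => q _; rewrite mxE mulr_suml; apply: eq_bigr => p _.
by rewrite [H^T q b]mxE; ring.
Qed.

Lemma skew_row_mul (R : realType) (A B : 'M[R]_3) (u p q : 'I_3) :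
  skew (row u (A *m B)) p q = \sum_(v < 3) A u v * skew (row v B) p q.
Proof. by rewrite !(mxE, sum_ord3); ring. Qed.

Lemma skew_contract (R : realType) (w k : 'rV[R]_3) (a : 'I_3) :
  \sum_(b < 3) skew w a b * k 0 b = (w *m skew k) 0 a.
Proof.
move: a; apply: forall_ord3; rewrite !(mxE, sum_ord3) /perm_symbol /=; ring.
Qed.

Lemma row_mul_skew (R : realType) (k : 'rV[R]_3) : k *m skew k = 0.
Proof.
apply/rowP; apply: forall_ord3; rewrite !(mxE, sum_ord3) /perm_symbol /=; ring.
Qed.

Lemma skew_mul_col (R : realType) (k : 'rV[R]_3) : skew k *m k^T = 0.
Proof.
apply: trmx_inj.
by rewrite trmx_mul trmxK tr_skew mulmxN row_mul_skew trmx0 oppr0.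
Qed.

(** Conceptually, let V' be the compression of V to the plane orthogonal to k. There K is |k| times
    a quarter turn J, and J V' J is minus the cofactor matrix of V'. The determinant is thus |k|^6
    det V' and the trace is -2 |k|^2 det V'. *)
Lemma det_skew_congr (R : realType) (V : 'M[R]_3) (k : 'rV[R]_3) :
  2 * \det (k^T *m k - skew k *m V *m skew k) =
  - (\sum_(i < 3) k 0 i ^+ 2) ^+ 2 * \tr (skew k *m V *m skew k *m V^T).
Proof.
have [[E00 E11 E22] [E01 E12 E20] [E10 E21 E02]] :
  [/\ [/\ skew k 0 0 = 0, skew k 1 1 = 0 & skew k 2 2 = 0],
      [/\ skew k 0 1 = k 0 2, skew k 1 2 = k 0 0 & skew k 2 0 = k 0 1]
    & [/\ skew k 1 0 = - k 0 2, skew k 2 1 = - k 0 0 & skew k 0 2 = - k 0 1]].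
  by split; split; rewrite mxE sum_ord3 /perm_symbol /=; ring.
(* Generalizing [skew k] to a matrix known only by its nine entries stops [mxE] from unfolding it
   into sums, so that [ring] meets a smaller polynomial identity. *)
move: (skew k) E00 E11 E22 E01 E12 E20 E10 E21 E02 => E.
move=> E00 E11 E22 E01 E12 E20 E10 E21 E02.
rewrite det3 /mxtrace !sum_ord3 !(mxE, sum_ord3, big_ord1).
rewrite ?E00 ?E11 ?E22 ?E01 ?E12 ?E20 ?E10 ?E21 ?E02.
ring.
Qed.

(** * Kernel vectors outside the line of k *)

Lemma exists_transverse_kernel (R : realType) (k : 'rV[R]_3) (V : 'M[R]_3) :
  k != 0 ->
  (exists a : 'rV[R]_3,
     a *m (skew k *m V *m skew k) = 0 /\ ~ (exists l : R, a = l *: k)) <->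
  \tr (skew k *m V *m skew k *m V^T) = 0.
Proof.
move=> k_neq0; set W := skew k *m V *m skew k.
have norm_neq0 : \sum_(i < 3) k 0 i ^+ 2 != 0.
  apply: contra_neq k_neq0 => /eqP.
  rewrite psumr_eq0 => [/allP k0|i _]; last exact: sqr_ge0.
  apply/rowP=> i; have := k0 i (mem_index_enum i).
  by rewrite mxE /= sqrf_eq0 => /eqP.
have kk : k *m k^T = (\sum_(i < 3) k 0 i ^+ 2)%:M.
  rewrite [LHS]mx11_scalar mxE; congr (_%:M).
  by apply: eq_bigr => i _; rewrite mxE expr2.
have kW : k *m W = 0 by rewrite /W !mulmxA row_mul_skew !mul0mx.
have Wk : W *m k^T = 0 by rewrite /W -mulmxA skew_mul_col mulmx0.
have detE : (\tr (W *m V^T) = 0) <-> \det (k^T *m k - W) = 0.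
  have := det_skew_congr V k; rewrite -/W => detW.
  split=> [tr0|det0].
    apply/eqP; move: detW; rewrite tr0 mulr0 => /eqP.
    by rewrite mulf_eq0 pnatr_eq0.
  move: detW; rewrite det0 mulr0 => /esym/eqP.
  by rewrite mulf_eq0 oppr_eq0 expf_eq0 (negPf norm_neq0) => /eqP.
rewrite detE; split=> [[a [aW a_k]]|/eqP/det0P[v v_neq0 vN]].
  apply/eqP/det0P.
  set s := \sum_(i < 3) k 0 i ^+ 2 in norm_neq0 kk.
  (* The component of a orthogonal to k: W kills it because W kills both a and k, and k^T k kills it
     by orthogonality. *)
  exists (a - (a *m k^T) 0 0 / s *: k).
    apply/eqP => /eqP; rewrite subr_eq0 => /eqP aE.
    by apply: a_k; exists ((a *m k^T) 0 0 / s).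
  rewrite mulmxBl !mulmxBr aW subr0 -!scalemxAl kW scaler0 subr0 !mulmxA kk.
  rewrite mul_scalar_mx scalerA divfK // [a *m k^T]mx11_scalar mul_scalar_mx.
  by rewrite [in X in _ - X]mxE eqxx mulr1n subrr.
(* Multiplying the kernel equation by k^T on the right removes W and leaves |k|^2 (v k^T) = 0.
   Orthogonality to k then gives v W = 0 and excludes nonzero multiples of k. *)
have vk0 : v *m k^T = 0.
  have /(congr1 (mulmx^~ k^T)) := vN.
  rewrite mul0mx -mulmxA mulmxBl Wk subr0 -mulmxA kk mul_mx_scalar -scalemxAr.
  by move/eqP; rewrite scaler_eq0 (negPf norm_neq0) => /eqP.
exists v; split.
  by move/eqP: vN; rewrite mulmxBr mulmxA vk0 mul0mx sub0r oppr_eq0 => /eqP.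
case=> l vE; move: vk0; rewrite vE -scalemxAl kk => /matrixP/(_ 0 0).
rewrite !mxE eqxx mulr1n => /eqP; rewrite mulf_eq0 (negPf norm_neq0) orbF.
by move=> /eqP l0; move: v_neq0; rewrite vE l0 scale0r eqxx.
Qed.

(** * Double dual of an array antisymmetric in each pair *)

Definition antisym_pairs (R : realType)
    (X : 'I_3 -> 'I_3 -> 'I_3 -> 'I_3 -> R) : Prop :=
  forall a b d e, X a b d e = - X b a d e /\ X a b d e = - X a b e d.

(* Index additions are modulo 3. *)
Definition double_dual (R : realType) (X : 'I_3 -> 'I_3 -> 'I_3 -> 'I_3 -> R) :
    'M[R]_3 :=
  \matrix_(e, f) X (f + 1) (f + 2) (e + 1) (e + 2).

Section Components.
Variables (R : realType) (X : 'I_3 -> 'I_3 -> 'I_3 -> 'I_3 -> R).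
Hypothesis X_anti : antisym_pairs X.
Let D := double_dual X.

(** Nested with the second pair outermost, the pair that the right dual contracts. *)
Lemma antisym_pairsEr (a b c d : 'I_3) :
  X a b c d = skew (\row_e skew (row e D) a b) c d.
Proof.
rewrite (skew_antisym c d (fun c d => (X_anti a b c d).2)).
congr (skew _ c d); apply/rowP=> e; rewrite !mxE.
rewrite (@skew_antisym _ (fun a b => X a b (e + 1) (e + 2)) a b); last first.
  by move=> a' b'; exact: (X_anti _ _ _ _).1.
by rewrite mxE; apply: eq_bigr => f _; rewrite !mxE.
Qed.

(** The opposite nesting, suited to the left dual; exchanging the pairs transposes D. *)
Lemma antisym_pairsEl (a b c d : 'I_3) :
  X a b c d = skew (\row_f skew (row f D^T) c d) a b.
Proof.
rewrite (@skew_antisym _ (fun a b => X a b c d) a b); last first.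
  by move=> a' b'; exact: (X_anti _ _ _ _).1.
congr (skew _ a b); apply/rowP=> f; rewrite !mxE.
rewrite (skew_antisym c d (fun c d => (X_anti (f + 1) (f + 2) c d).2)).
by rewrite mxE; apply: eq_bigr => e _; rewrite !mxE.
Qed.

(** * Duals and raised indices in terms of D and V *)

Variable G : 'M[R]_3.
Hypothesis G_sym : G^T = G.
Hypothesis G_unit : G \in unitmx.
Let H := invmx G.
Let V := G *m D *m G.
Let s := - (Num.sqrt (- \det G))^-1.

(** Since [pqe] [pqr] is twice the Kronecker delta, the factor 1/2 of the Hodge dual cancels. *)
Lemma eps_mixed_contract (v : 'rV[R]_3) (c : 'I_3) :
  2^-1 * (\sum_(p < 3) \sum_(q < 3) skew v p q * eps_mixed G p q c) =
  s * (v *m G) 0 c.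
Proof.
rewrite /eps_mixed /eps_up -/s !(mxE, sum_ord3) /perm_symbol /=.
by field.
Qed.

Lemma right_dualE (a b c : 'I_3) :
  right_dual G X a b c = s * skew (row c (G *m D)) a b.
Proof.
rewrite /right_dual.
under eq_bigr do under eq_bigr do rewrite antisym_pairsEr.
rewrite eps_mixed_contract skew_row_mul [(_ *m G) 0 c]mxE; congr (_ * _).
by apply: eq_bigr => f _; rewrite [(\row__ _) 0 f]mxE mulrC -{1}G_sym mxE.
Qed.

Lemma left_dualE (a b c : 'I_3) :
  left_dual G X a b c = s * skew (row a (G *m D^T)) b c.
Proof.
rewrite /left_dual.
under eq_bigr do under eq_bigr do rewrite antisym_pairsEl.
rewrite eps_mixed_contract skew_row_mul [(_ *m G) 0 a]mxE; congr (_ * _).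
by apply: eq_bigr => f _; rewrite [(\row__ _) 0 f]mxE mulrC -{1}G_sym mxE.
Qed.

Lemma tr_invmx_sym : H^T = H.
Proof. by rewrite /H trmx_inv G_sym. Qed.

Lemma left_dual_upE (a b c : 'I_3) :
  left_dual_up G X a b c = s * \det H * skew (row a (H *m V^T)) b c.
Proof.
rewrite /left_dual_up -/H skew_row_mul mulr_sumr; apply: eq_bigr => d _.
transitivity (H a d * s * \sum_(e < 3) \sum_(f < 3)
   H b e * H c f * skew (row d V^T *m H) e f).
  rewrite mulr_sumr; apply: eq_bigr => e _.
  rewrite mulr_sumr; apply: eq_bigr => f _.
  (* Exposing a right factor H gives the shape w H, on which [skew_congr_sum] trades the two raised
     indices for det H. *)
  rewrite left_dualE (_ : G *m D^T = V^T *m H) ?row_mul; first by ring.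
  by rewrite /V !trmx_mul G_sym /H -!mulmxA mulmxV // mulmx1.
by rewrite skew_congr_sum; ring.
Qed.

(** Each antisymmetric pair of raised indices contributes one det H. As D = H V H, each pair also
    absorbs one factor H, which leaves V. *)
Lemma raise4E (a b c d : 'I_3) :
  raise4 G X a b c d =
  \det H ^+ 2 * skew (\row_f skew (row f V) a b) c d.
Proof.
transitivity (\sum_(p < 3) \sum_(q < 3) H a p * H b q *
    \sum_(r < 3) \sum_(t < 3) H c r * H d t *
      skew (\row_f skew (row f (G *m D)) p q *m H) r t).
  apply: eq_bigr => p _; apply: eq_bigr => q _.
  rewrite mulr_sumr; apply: eq_bigr => r _.
  rewrite mulr_sumr; apply: eq_bigr => t _.
  rewrite antisym_pairsEr -/H.
  have -> : \row_e skew (row e D) p q = \row_f skew (row f (G *m D)) p q *m H.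
    apply/rowP=> e; rewrite [LHS]mxE [RHS]mxE.
    have {1}-> : D = H *m (G *m D) by rewrite /H mulKmx.
    rewrite skew_row_mul; apply: eq_bigr => f _.
    by rewrite [(\row__ _) 0 f]mxE mulrC -[in LHS]tr_invmx_sym [H^T _ _]mxE.
  by ring.
under eq_bigr do under eq_bigr do rewrite skew_congr_sum.
rewrite [in RHS]mxE.
transitivity (\sum_(e < 3) \sum_(p < 3) \sum_(q < 3)
    perm_symbol R c d e * \det H *
    (H a p * H b q * skew (row e V *m H) p q)).
  rewrite [RHS]exchange_big; apply: eq_bigr => p _.
  rewrite [RHS]exchange_big; apply: eq_bigr => q _.
  rewrite [skew (\row_f _) c d]mxE mulrA mulr_sumr; apply: eq_bigr => e _.
  rewrite [(\row_f _) 0 e]mxE -row_mul.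
  have -> : V *m H = G *m D by rewrite /V /H mulmxK.
  by ring.
rewrite mulr_sumr; apply: eq_bigr => e _.
under eq_bigr do rewrite -mulr_sumr.
by rewrite -mulr_sumr skew_congr_sum [(\row_f _) 0 e]mxE; ring.
Qed.

(** * Contractions with the wave covector *)

Lemma wave_operatorE (k : 'rV[R]_3) (i b : 'I_3) :
  \sum_(m < 3) \sum_(n < 3) raise4 G X i m b n * k 0 m * k 0 n =
  - \det H ^+ 2 * (skew k *m V *m skew k) b i.
Proof.
transitivity (\det H ^+ 2 * \sum_(n < 3)
   skew (row i (V *m skew k)^T) b n * k 0 n).
  rewrite exchange_big mulr_sumr; apply: eq_bigr => n _.
  have -> : row i (V *m skew k)^T =
      \row_f \sum_(m < 3) skew (row f V) i m * k 0 m.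
    apply/rowP=> f; rewrite [in RHS]mxE skew_contract -row_mul.
    by rewrite [LHS]mxE [LHS]mxE [RHS]mxE.
  rewrite [skew _ b n]mxE mulr_suml mulr_sumr.
  transitivity (\sum_(m < 3) \sum_(f < 3) \det H ^+ 2 *
     (perm_symbol R b n f * (skew (row f V) i m * k 0 m) * k 0 n)).
    apply: eq_bigr => m _; rewrite raise4E [skew (\row_f _) b n]mxE.
    rewrite mulr_sumr !mulr_suml; apply: eq_bigr => f _.
    by rewrite [(\row_f _) 0 f]mxE; ring.
  rewrite exchange_big; apply: eq_bigr => f _.
  by rewrite [(\row_f _) 0 f]mxE -mulr_sumr -mulr_suml -mulr_sumr.
rewrite skew_contract -row_mul mxE.
(* Antisymmetry of K gives the sign; the transpose makes b the row index. *)
have -> : (V *m skew k)^T *m skew k = (- (skew k *m V *m skew k))^T.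
  by rewrite -!mulNmx -tr_skew !trmx_mul trmxK !mulmxA.
rewrite [X in _ * X = _]mxE. by rewrite [X in _ * X = _]mxE mulrN mulNr.
Qed.

(** Contracting each dual with k separately gives matrices A and B, and the sum over k1, k2 is tr (A
    B^T). The factor H in A cancels the factor G in B^T by cyclicity of the trace. *)
Lemma dual_square_contract (k : 'rV[R]_3) :
  \sum_(i < 3) \sum_(j < 3) dual_square G X i j * k 0 i * k 0 j =
  - (s * \det H) ^+ 2 * \tr (skew k *m V *m skew k *m V^T).
Proof.
pose A := \matrix_(a, b) \sum_i left_dual_up G X a b i * k 0 i.
pose B := \matrix_(a, b) \sum_j right_dual_raise1 G X j a b * k 0 j.
transitivity (\tr (A *m B^T)).
  rewrite /mxtrace; under [RHS]eq_bigr do rewrite mxE.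
  rewrite /dual_square.
  transitivity (\sum_(i < 3) \sum_(a < 3) \sum_(j < 3) \sum_(b < 3)
     left_dual_up G X a b i * right_dual_raise1 G X j a b * k 0 i * k 0 j).
    apply: eq_bigr => i _; rewrite [RHS]exchange_big; apply: eq_bigr => j _.
    rewrite !mulr_suml; apply: eq_bigr => a _.
    by rewrite !mulr_suml.
  rewrite exchange_big; apply: eq_bigr => a _.
  transitivity (\sum_(i < 3) \sum_(b < 3) \sum_(j < 3)
     left_dual_up G X a b i * right_dual_raise1 G X j a b * k 0 i * k 0 j).
    by apply: eq_bigr => i _; rewrite exchange_big.
  rewrite exchange_big; apply: eq_bigr => b _.
  rewrite [B^T b a]mxE [A a b]mxE [B a b]mxE mulr_suml; apply: eq_bigr => i _.
  by rewrite mulr_sumr; apply: eq_bigr => j _; ring.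
have -> : A = (s * \det H) *: (H *m V^T *m skew k).
  apply/matrixP=> a b; rewrite [LHS]mxE [RHS]mxE.
  have -> : (H *m V^T *m skew k) a b = (row a (H *m V^T) *m skew k) 0 b.
    by rewrite -row_mul [RHS]mxE.
  rewrite -skew_contract mulr_sumr.
  by apply: eq_bigr => i _; rewrite left_dual_upE mulrA.
have -> : B^T = (- (s * \det H)) *: (V *m skew k *m G).
  (* [skew_congr] for the symmetric H, multiplied on both sides by its inverse G. *)
  have kHE : skew (k *m H) = \det H *: (G *m skew k *m G).
    have := skew_congr H k; rewrite tr_invmx_sym => HkH.
    rewrite scalemxAl scalemxAr -HkH /H !mulmxA mulmxV // mul1mx.
    by rewrite -mulmxA mulVmx // mulmx1.
  have -> : (- (s * \det H)) *: (V *m skew k *m G) =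
      - s *: (G *m D *m skew (k *m H)).
    by rewrite kHE -scalemxAr scalerA -mulNr /V !mulmxA.
  apply/matrixP=> b a; rewrite [LHS]mxE [LHS]mxE [RHS]mxE.
  have -> : (G *m D *m skew (k *m H)) b a =
      (row b (G *m D) *m skew (k *m H)) 0 a by rewrite -row_mul [RHS]mxE.
  rewrite -skew_contract mulr_sumr.
  transitivity (\sum_(j < 3) \sum_(d < 3)
     H j d * right_dual G X d a b * k 0 j).
    by apply: eq_bigr => j _; rewrite mulr_suml.
  rewrite exchange_big; apply: eq_bigr => d _.
  rewrite [(k *m H) 0 d]mxE !mulr_sumr; apply: eq_bigr => j _.
  (* The swap by [skewC] is the source of the minus sign in B^T. *)
  by rewrite right_dualE skewC; ring.
rewrite -scalemxAl -scalemxAr scalerA mxtraceZ mulrN -expr2; congr (_ * _).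
rewrite -!mulmxA mxtrace_mulC !mulmxA -!mulmxA mulmxV // mulmx1.
by rewrite mxtrace_mulC !mulmxA.
Qed.

(** Both symmetrized terms have the same contraction with k_a k_b, so only the overall factor -1/2
    remains. *)
Lemma optical_metric_contract (k : 'rV[R]_3) :
  \sum_(a < 3) \sum_(b < 3) optical_metric G X a b * k 0 a * k 0 b =
  2^-1 * (s * \det H) ^+ 2 * \tr (skew k *m V *m skew k *m V^T).
Proof.
set T := \tr _.
set S := \sum_(i < 3) \sum_(j < 3) dual_square G X i j * k 0 i * k 0 j.
have SE : S = - (s * \det H) ^+ 2 * T by exact: dual_square_contract.
transitivity (- 2^-1 * S); last by rewrite SE; field.
transitivity (- 2^-1 * (2^-1 * (S + S))); last by field.
have {2}-> : S = \sum_(i < 3) \sum_(j < 3) dual_square G X j i * k 0 i * k 0 j.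
  rewrite /S exchange_big; apply: eq_bigr => i _; apply: eq_bigr => j _.
  by rewrite mulrAC.
rewrite /S -big_split mulrA mulr_sumr; apply: eq_bigr => a _.
rewrite -big_split mulr_sumr; apply: eq_bigr => b _.
by rewrite /optical_metric /=; ring.
Qed.

End Components.

(** * Lorentzian sign of the determinant and the equivalence at a point *)

Lemma signature_mpp_det_lt0 (R : realType) (G : 'M[R]_3) :
  signature_mpp G -> \det G < 0.
Proof.
case=> _ [P P_unit PGP].
have := congr1 determinant PGP.
rewrite !det_mulmx det_tr det_diag !big_ord_recl big_ord0 !mxE /= => detE.
have P2_gt0 : 0 < \det P ^+ 2.
  by rewrite lt_def sqr_ge0 expf_neq0 // -unitfE -unitmxE.
rewrite -(pmulr_rlt0 _ P2_gt0); lra.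
Qed.

Theorem mainTheorem2 (R : realType) (M : manifold3 R)
  (g : tensor_field M 2) (hg : lorentzian g)
  (X : tensor_field M 4) (hX : pairwise_antisymmetric X)
  (x : M) (c : chart R M) (hc : atlas c) (hx : dom c x)
  (k : 'rV[R]_3) (hk : k != 0) :
  (exists a : 'rV[R]_3,
     (forall i : 'I_3,
        \sum_(b < 3) (\sum_(m < 3) \sum_(n < 3)
          raise4 (metric_at g c x) (tensor4_at X c x) i m b n
            * k 0 m * k 0 n) * a 0 b = 0)
     /\ ~ (exists l : R, a = l *: k))
  <->
  \sum_(a < 3) \sum_(b < 3)
    optical_metric (metric_at g c x) (tensor4_at X c x) a b
      * k 0 a * k 0 b = 0.
Proof.
have sigG := hg.2 c x hc hx.
set G := metric_at g c x in sigG *; set Y := tensor4_at X c x.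
have Y_anti : antisym_pairs Y by move=> a b d e; exact: hX.
have detG := signature_mpp_det_lt0 sigG.
have G_sym := sigG.1.
have G_unit : G \in unitmx by rewrite unitmxE unitfE lt_eqF.
have detH : \det (invmx G) != 0 by rewrite det_inv invr_eq0 lt_eqF.
(* The sign of det G matters: [Num.sqrt] is 0 at nonpositive arguments, and the inverse of 0 is
   0. *)
have s_neq0 : - (Num.sqrt (- \det G))^-1 != 0.
  by rewrite oppr_eq0 invr_eq0 sqrtr_eq0 -ltNge oppr_gt0.
rewrite optical_metric_contract //.
set V := G *m double_dual Y *m G.
set T := \tr _.
have -> : (2^-1 * (- (Num.sqrt (- \det G))^-1 * \det (invmx G)) ^+ 2 * T = 0)
    <-> T = 0.
  split=> [/eqP|->]; last by rewrite mulr0.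
  by rewrite !mulf_eq0 !(negPf detH, negPf s_neq0) invr_eq0 pnatr_eq0 => /eqP.
rewrite /T -(exists_transverse_kernel V hk).
(* As b is the row index, contraction with a_b is multiplication of the row a by K V K, the kernel
   side used in [exists_transverse_kernel]. *)
have waveE (a : 'rV[R]_3) i :
    \sum_(b < 3) (\sum_(m < 3) \sum_(n < 3)
       raise4 G Y i m b n * k 0 m * k 0 n) * a 0 b =
    - \det (invmx G) ^+ 2 * (a *m (skew k *m V *m skew k)) 0 i.
  rewrite mxE mulr_sumr; apply: eq_bigr => b _.
  by rewrite wave_operatorE //; ring.
split=> -[a [aW a_k]]; exists a; split=> //.
  apply/rowP=> i; have /eqP := aW i.
  rewrite waveE mulf_eq0 oppr_eq0 expf_eq0 (negPf detH) /= => /eqP ->.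
  by rewrite mxE.
by move=> i; rewrite waveE aW mxE mulr0.
Qed.
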